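(* Let $k\in\mathbb C$ with $\Re(k)>0$, let $f:\mathbb Q\to\mathbb C$ be $1$-periodic, and let $h:\mathbb R\setminus\{0\}\to\mathbb C$ satisfy $h(x)=f(x)-|x|^{-k}f(-1/x)$ for $x\in\mathbb Q\setminus\{0\}$ and $h(x)=O(|x|^{-\Re(k)})$ for $0<|x|\leq1$. Then the function $$f^\ast(x):=\begin{cases} q^{-k}f(\overline{x}) & x=\tfrac aq\in\mathbb Q,\\ \lim_{\mathbb Q\ni y=\frac aq\to x}q^{-k}f(\overline{y}) & x\notin\mathbb Q\end{cases}$$ is well defined and is a continuous function of $x\in\mathbb R\setminus\mathbb Q$. Furthermore, if $h(x)=o(|x|^{-\Re(k)})$ as $x\to0$, then $f^\ast$ is continuous on $\mathbb R$. Finally, there exists a set $X\subset\mathbb R$ of full Lebesgue measure such that $f^\ast$ is $\alpha$-Hölder continuous at every point of $X$, for every $\alpha<\frac12\Re(k)$. In particular, if $\Re(k)>2$, then $f^\ast$ has derivative zero almost everywhere.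
   Context: For a rational $x=a/q$ in reduced form with $q\ge1$, $\overline{x}:=\overline{a}_q/q$ where $\overline a_q\in(0,q]$ is the integer with $a\overline a_q\equiv1\pmod q$. In the limit, $y=a/q$ is written in reduced form. *)

(* Defs.v *)
From HB Require Import structures.
From mathcomp Require Import all_boot all_order all_algebra.
From mathcomp Require Import all_classical all_reals all_analysis.
From mathcomp Require Import complex.
Set Implicit Arguments. Unset Strict Implicit. Unset Printing Implicit Defensive.
Import Order.TTheory GRing.Theory Num.Theory.
Local Open Scope ring_scope.
Local Open Scope classical_set_scope.

Definition cnorm (R : realType) (z : R[i]) : R := Normc.normc z.

Definition cpow (R : realType) (x : R) (s : R[i]) : R[i] :=
  let r := expR (complex.Re s * ln x) in
  let t := complex.Im s * ln x in
  Complex (r * cos t) (r * sin t).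

(* for coprime a, q with q >= 1: the integer abar in (0, q] with
   a * abar = 1 mod q (u is a Bezout coefficient: u a + v q = 1) *)
Definition inv_mod (a q : int) : int :=
  let u := (egcdz a q).1 in ((u - 1) %% q)%Z + 1.

Definition rbar (x : rat) : rat :=
  (inv_mod (numq x) (denq x))%:~R / (denq x)%:~R.

Definition fstar_rat (R : realType) (k : R[i]) (f : rat -> R[i]) (y : rat)
  : R[i] := cpow ((denq y)%:~R : R) (- k) * f (rbar y).

Definition is_rational (R : realType) (x : R) : Prop :=
  exists y : rat, ratr y = x.

Definition ccont_at (R : realType) (F : R -> R[i]) (x : R) : Prop :=
  forall e : R, 0 < e -> exists2 d : R, 0 < d &
    forall y : R, `|y - x| < d -> cnorm (F y - F x) < e.

Definition holder_at (R : realType) (F : R -> R[i]) (alpha x : R) : Prop :=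
  exists C : R, exists2 d : R, 0 < d &
    forall y : R, `|y - x| < d -> cnorm (F y - F x) <= C * `|y - x| `^ alpha.

Definition deriv0_at (R : realType) (F : R -> R[i]) (x : R) : Prop :=
  forall e : R, 0 < e -> exists2 d : R, 0 < d &
    forall y : R, `|y - x| < d -> cnorm (F y - F x) <= e * `|y - x|.

(* Main.v *)
Require Import Defs.
From HB Require Import structures.
From mathcomp Require Import all_boot all_order all_algebra.
From mathcomp Require Import all_classical all_reals all_analysis.
From mathcomp Require Import complex.
From mathcomp Require Import zify ring lra.
Import Order.TTheory GRing.Theory Num.Theory.
Local Open Scope ring_scope.
Local Open Scope classical_set_scope.

(** If [p/s] and [p'/s'] are Farey neighbours, [p' s - p s' = e] with [e] a sign,
    then the inverse of [p] mod [s] is [- e s'] and that of [p'] mod [s'] is [e s],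
    so the reciprocity formula reads
    [fstar (p/s) - fstar (p'/s') = - s'^(-k) h (e s / s')].  The bound on [h] turns
    this into [|fstar (p/s) - fstar (p'/s')| <= C min(s, s')^(-Re k)].  A rational
    inside a Farey interval descends to an endpoint through neighbours whose
    denominators at least halve at each step, so on the rationals of that interval
    [fstar] oscillates by [O(min(s, s')^(-Re k))].
    An irrational lies in Farey intervals with both denominators arbitrarily large,
    which gives the limit and its continuity.  Near a rational [p/s] one uses the
    intervals between consecutive neighbours [(p' + n p)/(s' + n s)], and [h = o]
    controls the remaining jump to [p/s].  If [|x - a/q| >= c q^(-2-eta)] for all
    [a/q], the smallest Stern-Brocot interval around the ball of radius [t] about [x]
    has both denominators at least of order [t^(-1/((1+eta)(2+eta)))], hence the
    Hoelder exponents below [Re k / 2]; such [x] have full measure for each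
    [eta > 0]. *)

(** * Reciprocity for Farey neighbours *)

Lemma cnormD {R : realType} (x y : R[i]) : cnorm (x + y) <= cnorm x + cnorm y.
Proof. exact: le_normcD. Qed.

Lemma cnormM {R : realType} (x y : R[i]) : cnorm (x * y) = cnorm x * cnorm y.
Proof. exact: Normc.normcM. Qed.

Lemma cnormB {R : realType} (x y : R[i]) : cnorm (x - y) = cnorm (y - x).
Proof. by rewrite -opprB; exact: normcN. Qed.

Lemma cnorm_ge0 {R : realType} (x : R[i]) : 0 <= cnorm x.
Proof. by case: x => a b; exact: sqrtr_ge0. Qed.

Lemma cnorm0 {R : realType} : cnorm (0 : R[i]) = 0.
Proof. exact: Normc.normc0. Qed.

Lemma cnorm_dist {R : realType} (y x z : R[i]) :
  cnorm (x - z) <= cnorm (x - y) + cnorm (y - z).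
Proof. by rewrite -(subrKA y); exact: cnormD. Qed.

Lemma cnorm_cpow {R : realType} (x : R) (s : R[i]) : 0 < x ->
  cnorm (cpow x s) = x `^ complex.Re s.
Proof.
move=> x0; rewrite /cnorm /cpow /= !exprMn -mulrDr cos2Dsin2 mulr1.
by rewrite sqrtr_sqr ger0_norm ?expR_ge0// /powR gt_eqF.
Qed.

Lemma cpowM {R : realType} (x y : R) (s : R[i]) : 0 < x -> 0 < y ->
  cpow (x * y) s = cpow x s * cpow y s.
Proof.
move=> x0 y0; rewrite /cpow lnM ?posrE// !mulrDr expRD cosD sinD.
by apply/eqP; rewrite eq_complex /=; apply/andP; split; apply/eqP; ring.
Qed.

Lemma periodic_int {A : Type} (f : rat -> A) (x : rat) (n : int) :
  (forall x, f (x + 1) = f x) -> f (x + n%:~R) = f x.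
Proof.
move=> f1; have fn (m : nat) z : f (z + m%:R) = f z.
  by elim: m => [|m IH]; rewrite ?addr0// -natr1 addrA f1.
by case: n => m; [exact: fn|rewrite NegzE mulrNz -(fn m.+1 (x - _)) subrK].
Qed.

(** Two inverses of [a] modulo [q] are congruent: multiply each by the Bezout relation of the other
    and subtract. *)
Lemma inv_mod_eq (a q u v : int) : a * u = 1 + v * q ->
  exists n, inv_mod a q = u + n * q.
Proof.
move=> auv; rewrite /inv_mod.
have aq : coprimez a q by apply/coprimezP; exists (u, - v) => /=; lia.
case: egcdzP => w v' wv _ /=; move: wv; rewrite (eqP aq) => wv.
exists (- v * w - u * v' - ((w - 1) %/ q)%Z).
have := divz_eq (w - 1) q; set d := (_ %/ _)%Z; set r := (_ %% _)%Z => E.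
have -> : r = w - 1 - d * q by rewrite E; ring.
transitivity (u + (w * (a * u - v * q) - u * (w * a + v' * q)) - d * q).
  by rewrite wv auv; ring.
by ring.
Qed.

Section Reciprocity.
Context {R : realType} (k : R[i]) (f : rat -> R[i]) (h : R -> R[i]).
Hypothesis f_per : forall x, f (x + 1) = f x.
Hypothesis fh : forall x : rat, x != 0 ->
  h (ratr x) = f x - cpow `|ratr x| (- k) * f (- x^-1).

(** Periodicity of [f] lets any inverse of [a] modulo [q] stand in for the reduced one. *)
Lemma fstar_ratE (a q u v : int) : 0 < q -> a * u = 1 + v * q ->
  fstar_rat k f (a%:~R / q%:~R) = cpow (q%:~R : R) (- k) * f (u%:~R / q%:~R).
Proof.
move=> q0 auv; rewrite /fstar_rat /rbar.
have aq : coprime `|a| `|q|.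
  by apply/(@coprimezP a q); exists (u, - v) => /=; lia.
rewrite coprimeq_num// coprimeq_den// (gt_eqF q0) gtr0_sg// mul1r gtr0_norm//.
have [n ->] := inv_mod_eq a q u v auv.
rewrite rmorphD rmorphM /= mulrDl mulfK ?periodic_int//.
by rewrite intr_eq0 gt_eqF.
Qed.

(* The sign [e] records on which side of [p/s] its Farey neighbour [p'/s'] lies. *)
Lemma fstar_nbr_le (c d : R) (e p s p' s' : int) :
  (forall x, 0 < `|x| <= d -> cnorm (h x) <= c * `|x| `^ (- complex.Re k)) ->
  e * e = 1 -> 0 < s -> 0 < s' -> p' * s - p * s' = e ->
  s%:~R <= d * s'%:~R ->
  cnorm (fstar_rat k f (p%:~R / s%:~R) - fstar_rat k f (p'%:~R / s'%:~R))
    <= c * s%:~R `^ (- complex.Re k).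
Proof.
move=> hle ee s0 s'0 pp sd.
rewrite (fstar_ratE p s (- (e * s')) (- (e * p')))//; last by rewrite -ee -pp; ring.
rewrite (fstar_ratE p' s' (e * s) (e * p))//; last by rewrite -ee -pp; ring.
have sR0 : 0 < s%:~R :> R by rewrite ltr0z.
have s'R0 : 0 < s'%:~R :> R by rewrite ltr0z.
have sQ0 : s%:~R != 0 :> rat by rewrite intr_eq0 gt_eqF.
have s'Q0 : s'%:~R != 0 :> rat by rewrite intr_eq0 gt_eqF.
have eV : (e%:~R)^-1 = e%:~R :> rat.
  have ee' : e%:~R * e%:~R = 1 :> rat by rewrite -rmorphM /= ee.
  by rewrite -[LHS]mulr1 -{2}ee' mulKf//; apply/eqP => e0; move: ee'; rewrite e0 mul0r.
have e1 : `|e%:~R| = 1 :> R.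
  have [->|->] : e = 1 \/ e = -1 by nia.
    by rewrite normr1.
  by rewrite rmorphN /= normrN normr1.
have x0 : (e * s)%:~R / s'%:~R != 0 :> rat.
  by rewrite mulf_neq0 ?invr_eq0// intr_eq0; apply/eqP; nia.
have nx : `|ratr ((e * s)%:~R / s'%:~R : rat)| = s%:~R / s'%:~R :> R.
  rewrite fmorph_div /= !ratr_int rmorphM /= !normrM e1 mul1r normfV.
  by rewrite !gtr0_norm.
have := fh _ x0; rewrite nx.
(* For [x = e s / s'], the point [- 1 / x] is the argument of [f] attached to [p/s], so one value of
   [h] compares both terms. *)
have -> : - ((e * s)%:~R / s'%:~R)^-1 = (- (e * s'))%:~R / s%:~R :> rat.
  by rewrite invf_div !rmorphN /= !rmorphM /= invfM eV; field.
set F := f (_ / s%:~R); set F' := f (_ / s'%:~R); set X := ratr _ => hX.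
have -> : cpow (s%:~R : R) (- k) * F - cpow (s'%:~R : R) (- k) * F' =
    - (cpow (s'%:~R : R) (- k) * h X).
  rewrite hX -{1}[s%:~R](@divfK R s'%:~R) ?gt_eqF// cpowM ?divr_gt0//; ring.
rewrite /cnorm normcN -/(cnorm _) cnormM cnorm_cpow//.
have hXle : cnorm (h X) <= c * (s%:~R / s'%:~R) `^ (- complex.Re k).
  by rewrite -nx; apply: hle; rewrite nx divr_gt0//= ler_pdivrMr.
have -> : complex.Re (- k) = - complex.Re k by case: (k).
apply: (le_trans (ler_wpM2l (powR_ge0 _ _) hXle)).
rewrite mulrCA -powRM; [|exact: ltW|exact/ltW/divr_gt0].
by rewrite (mulrC s'%:~R) divfK ?gt_eqF.
Qed.

End Reciprocity.

(** * Oscillation on a Farey interval *)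

Lemma ge0_powRN_le {R : realType} (r x y : R) : 0 <= r -> 0 < x -> x <= y ->
  y `^ (- r) <= x `^ (- r).
Proof.
move=> r0 x0 xy; rewrite !powRN lef_pV2 ?posrE ?powR_gt0//; last exact: lt_le_trans xy.
by apply: ge0_ler_powR => //; rewrite nnegrE ltW// (lt_le_trans x0).
Qed.

Lemma eq_intfrac (a q b d : int) : 0 < q -> 0 < d -> a * d = b * q ->
  a%:~R / q%:~R = b%:~R / d%:~R :> rat.
Proof.
move=> q0 d0 E.
have qn0 : q%:~R != 0 :> rat by rewrite intr_eq0 gt_eqF.
have dn0 : d%:~R != 0 :> rat by rewrite intr_eq0 gt_eqF.
by apply/eqP; rewrite eqr_div// -!intrM E.
Qed.

Lemma mulz_gtN_ge0 (q z x : int) : q * z = x -> 0 < q -> - q < x -> 0 <= z.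
Proof. by move=> <- q0; rewrite -mulrN1 ltr_pM2l//; lia. Qed.

(** The inverse [d] of [a] modulo [q] and [q - d] both give Farey neighbours of [a/q], with opposite
    signs; the smaller is at most [q / 2]. *)
Lemma farey_parent (a q : int) : 1 < q -> coprimez a q ->
  exists e b d, [/\ e * e = 1, 0 < d, 2 * d <= q & a * d - b * q = e].
Proof.
move=> q1 /coprimezP[[u v] /= uv].
pose d := (u %% q)%Z; pose b := - (a * (u %/ q)%Z) - v.
have ud : u = (u %/ q)%Z * q + d by exact: divz_eq.
have d0 : 0 <= d by apply: modz_ge0; lia.
have dq : d < q by apply: ltz_pmod; lia.
have E : a * d - b * q = 1.
  by rewrite /b -uv; set t := (u %/ q)%Z in ud *; rewrite [in RHS]ud; ring.
clear ud; clearbody b d.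
have d1 : d != 0.
  by apply/eqP => d00; move: E; rewrite d00 mulr0; case: (leP 0 b); nia.
have [dl|dg] := leP (2 * d) q.
  by exists 1, b, d; split => //; lia.
by exists (-1), (a - b), (q - d); split => //; lia.
Qed.

Section FareyInterval.
Context {R : realType} (k : R[i]) (f : rat -> R[i]) (h : R -> R[i]).
Hypothesis k0 : 0 < complex.Re k.
Hypothesis f_per : forall x, f (x + 1) = f x.
Hypothesis fh : forall x : rat, x != 0 ->
  h (ratr x) = f x - cpow `|ratr x| (- k) * f (- x^-1).
Context (C : R).
Hypothesis h_bigO : forall x : R, 0 < `|x| <= 1 ->
  cnorm (h x) <= C * `|x| `^ (- complex.Re k).

Let kap := complex.Re k.
Let g (a q : int) := fstar_rat k f (a%:~R / q%:~R).
(** Sum of the geometric series [C 2 ^ (- j kap)], the total cost of a descent with halving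
    denominators. *)
Let A := C / (1 - 2 `^ (- kap)).

Lemma bigO_const_ge0 : 0 <= C.
Proof.
have := h_bigO 1; rewrite normr1 ltr01 lexx powR1 mulr1 => /(_ isT).
by apply: le_trans; exact: cnorm_ge0.
Qed.

Lemma two_powRN_lt1 : 2 `^ (- kap) < 1 :> R.
Proof.
rewrite powRN invf_lt1 ?powR_gt0//.
have : 1 `^ kap < 2 `^ kap :> R by apply: gt0_ltr_powR; rewrite ?nnegrE ?ltr1n.
by rewrite powR1.
Qed.

Let A_ge0 : 0 <= A.
Proof. by rewrite divr_ge0 ?bigO_const_ge0// subr_ge0 ltW// two_powRN_lt1. Qed.

(* The potential [A * (m ^ -kap - q ^ -kap)] absorbs one descent step, as the
   denominator at least halves when [a/q] is replaced by [b/d]. *)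
Lemma fstar_farey_potential (e p s p' s' m : int) :
  e * e = 1 -> 0 < m -> m <= s -> m <= s' -> p' * s - p * s' = e ->
  forall (n : nat) (a q : int), 0 < q -> q <= n%:Z -> coprimez a q ->
  0 <= e * (a * s - p * q) -> 0 <= e * (p' * q - a * s') ->
  let B := A * (m%:~R `^ (- kap) - q%:~R `^ (- kap)) in
  cnorm (g a q - g p s) <= B \/ cnorm (g a q - g p' s') <= B.
Proof.
move=> ee m0 ms ms' pp; elim=> [|n IH] a q q0 qn aq X0 Y0 /=; first by lia.
have eE : e = 1 \/ e = -1 by nia.
(* [X] and [Y] are the coordinates of [(a, q)] in the basis [(p', s')], [(p, s)]; one of them
   vanishes exactly at an endpoint. *)
set X := e * _ in X0; set Y := e * (p' * q - _) in Y0.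
have qXY : q = s * Y + s' * X.
  by rewrite -[LHS]mul1r -ee -{2}pp /X /Y; ring.
have mq : m <= q.
  move: (X) (Y) X0 Y0 qXY => x y x0 y0 E.
  have [x1|x1] := leP x 0; last by nia.
  have y1 : 0 < y by rewrite ltNge; apply/negP => y1; nia.
  by nia.
have mR0 : 0 < m%:~R :> R by rewrite ltr0z.
have B0 : 0 <= A * (m%:~R `^ (- kap) - q%:~R `^ (- kap)).
  by rewrite mulr_ge0// subr_ge0 ge0_powRN_le ?ler_int// ltW.
have [X1|X1] := eqVneq X 0.
  left; rewrite /g (eq_intfrac a q p s) ?subrr ?cnorm0//; first lia.
  by move: X1; rewrite /X => X1; case: eE X1 => ->; rewrite ?mul1r ?mulN1r; lia.
have [Y1|Y1] := eqVneq Y 0.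
  right; rewrite /g (eq_intfrac a q p' s') ?subrr ?cnorm0//; first lia.
  by move: Y1; rewrite /Y => Y1; case: eE Y1 => ->; rewrite ?mul1r ?mulN1r; lia.
have q1 : 1 < q.
  by move: (X) (Y) X0 Y0 X1 Y1 qXY => x y x0 y0 /eqP x1 /eqP y1 E; nia.
have [e' [b [d [ee' d0 dq abe]]]] := farey_parent a q q1 aq.
have e'E : e' = 1 \/ e' = -1 by nia.
(* The parent [b/d] has coordinates [X d / q] and [Y d / q] up to [s / q] and [s' / q], both less
   than 1. Integers above -1 are nonnegative, so [b/d] stays in the interval. *)
have Xd : q * (e * (b * s - p * d)) = X * d - e * e' * s.
  by rewrite -abe /X; ring.
have Yd : q * (e * (p' * d - b * s')) = Y * d + e * e' * s'.
  by rewrite -abe /Y; ring.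
have [sq s'q] : s < q /\ s' < q.
  move: (X) (Y) X0 Y0 X1 Y1 qXY => x y x0 y0 /eqP x1 /eqP y1 E; split.
    have : s * 1 <= s * y by apply: ler_wpM2l; lia.
    have : s' * 1 <= s' * x by apply: ler_wpM2l; lia.
    by lia.
  have : s * 1 <= s * y by apply: ler_wpM2l; lia.
  have : s' * 1 <= s' * x by apply: ler_wpM2l; lia.
  by lia.
have eeE : e * e' = 1 \/ e * e' = -1 by case: eE => ->; case: e'E => ->; [left|right|right|left].
have Xd0 : 0 <= e * (b * s - p * d).
  apply: (mulz_gtN_ge0 q _ _ Xd q0); have : 0 <= X * d by rewrite mulr_ge0// ltW.
  by case: eeE => ->; lia.
have Yd0 : 0 <= e * (p' * d - b * s').
  apply: (mulz_gtN_ge0 q _ _ Yd q0); have : 0 <= Y * d by rewrite mulr_ge0// ltW.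
  by case: eeE => ->; lia.
have bd : coprimez b d by apply/coprimezP; exists (- e' * q, e' * a) => /=; lia.
have dR0 : 0 < d%:~R :> R by rewrite ltr0z.
have := fstar_nbr_le k f h f_per fh C 1 e' b d a q h_bigO ee' d0 q0 abe.
rewrite mul1r ler_int => /(_ ltac:(lia)); rewrite -/(g _ _) -/(g _ _) -/kap => step.
(* [q >= 2 d] gives [A (d ^ (- kap) - q ^ (- kap)) >= C d ^ (- kap)]: the change of potential pays
   for the step. *)
have pot : C * d%:~R `^ (- kap) + A * (m%:~R `^ (- kap) - d%:~R `^ (- kap)) <=
    A * (m%:~R `^ (- kap) - q%:~R `^ (- kap)).
  have CA : C = A * (1 - 2 `^ (- kap)).
    by rewrite divfK// gt_eqF// subr_gt0 two_powRN_lt1.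
  have : q%:~R `^ (- kap) <= 2 `^ (- kap) * d%:~R `^ (- kap) :> R.
    rewrite -powRM ?(ltW dR0)//; apply: ge0_powRN_le; rewrite ?(ltW k0) ?mulr_gt0//.
    by rewrite -[2]/(2%:~R) -intrM ler_int.
  move=> /(ler_wpM2l A_ge0); rewrite CA; lra.
have [H|H] := IH b d d0 ltac:(lia) bd Xd0 Yd0; [left|right];
  apply: le_trans (cnorm_dist (g b d) _ _) _; rewrite cnormB;
  by apply: le_trans (lerD step H) pot.
Qed.

(** The descent ends at one of the endpoints; if at [p'/s'], one more jump between neighbours costs
    [C m ^ (- kap)]. *)
Lemma fstar_farey_le (e p s p' s' m a q : int) :
  e * e = 1 -> 0 < m -> m <= s -> m <= s' -> p' * s - p * s' = e ->
  0 < q -> coprimez a q ->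
  0 <= e * (a * s - p * q) -> 0 <= e * (p' * q - a * s') ->
  cnorm (g a q - g p s) <= (A + C) * m%:~R `^ (- kap).
Proof.
move=> ee m0 ms ms' pp q0 aq X0 Y0.
have qn : q <= `|q|%N%:Z by lia.
have mR0 : 0 < m%:~R :> R by rewrite ltr0z.
have mono (t : int) : m <= t -> C * t%:~R `^ (- kap) <= C * m%:~R `^ (- kap).
  move=> mt; apply: ler_wpM2l; first exact: bigO_const_ge0.
  by apply: ge0_powRN_le; rewrite ?ler_int// ltW.
have ends : cnorm (g p s - g p' s') <= C * m%:~R `^ (- kap).
  have [ss|ss] := leP s s'.
    apply: le_trans (mono s ms).
    apply: (fstar_nbr_le k f h f_per fh C 1 e) => //; try lia.
    by rewrite mul1r ler_int.
  rewrite cnormB; apply: le_trans (mono s' ms').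
  apply: (fstar_nbr_le k f h f_per fh C 1 (- e)) => //; try lia.
  by rewrite mul1r ler_int ltW.
have AC : A * (m%:~R `^ (- kap) - q%:~R `^ (- kap)) <= A * m%:~R `^ (- kap).
  by rewrite ler_wpM2l// gerBl powR_ge0.
have [H|H] := fstar_farey_potential e p s p' s' m ee m0 ms ms' pp _ a q q0 qn aq X0 Y0.
  apply: le_trans H _; apply: le_trans AC _.
  by rewrite mulrDl lerDl mulr_ge0 ?powR_ge0// bigO_const_ge0.
apply: le_trans (cnorm_dist (g p' s') _ _) _; rewrite mulrDl (cnormB _ (g p s)).
by apply: lerD => //; apply: le_trans H AC.
Qed.

End FareyInterval.

(** * Limits along the rationals and Stern-Brocot intervals *)

Lemma rat_near {R : realType} (x d : R) : 0 < d ->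
  exists y : rat, `|ratr y - x| < d.
Proof.
move=> d0; have [|y] := @rat_in_itvoo R (x - d) (x + d); first by lra.
by rewrite in_itv /= => /andP[y1 y2]; exists y; rewrite ltr_norml; lra.
Qed.

(** The limit is the supremum of the eventual lower bounds of [g] near [x]: oscillation at most [e]
    puts [g y - e] among them and makes [g y + e] an upper bound. *)
Lemma rat_cauchy_real {R : realType} (g : rat -> R) (x : R) :
  (forall e : R, 0 < e -> exists2 d : R, 0 < d & forall y z : rat,
     `|ratr y - x| < d -> `|ratr z - x| < d -> `|g y - g z| <= e) ->
  exists L : R, forall e : R, 0 < e -> exists2 d : R, 0 < d &
    forall y : rat, `|ratr y - x| < d -> `|g y - L| <= e.
Proof.
move=> gC.
pose S := [set t : R | exists2 d : R, 0 < d &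
  forall y : rat, `|ratr y - x| < d -> t <= g y].
have S_ub (e d : R) (y : rat) : 0 < d ->
    (forall y z : rat, `|ratr y - x| < d -> `|ratr z - x| < d ->
      `|g y - g z| <= e) ->
    `|ratr y - x| < d -> ubound S (g y + e).
  move=> d0 gd yd t [d' d'0 td'].
  have [z] : exists z : rat, `|ratr z - x| < Num.min d d'.
    by apply: rat_near; rewrite lt_min d0.
  rewrite lt_min => /andP[zd zd'].
  by have := gd _ _ yd zd; have := td' _ zd'; rewrite ler_norml; lra.
have S_in (e d : R) (y : rat) : 0 < d ->
    (forall y z : rat, `|ratr y - x| < d -> `|ratr z - x| < d ->
      `|g y - g z| <= e) ->
    `|ratr y - x| < d -> S (g y - e).
  move=> d0 gd yd; exists d => // z zd.
  by have := gd _ _ yd zd; rewrite ler_norml; lra.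
have S_sup : has_sup S.
  have [d d0 gd] := gC 1 ltr01; have [y yd] := rat_near x d d0.
  by split; [exists (g y - 1); exact: (S_in 1 d)|exists (g y + 1); exact: (S_ub 1 d)].
exists (sup S) => e e0; have [d d0 gd] := gC e e0; exists d => // y yd.
have := sup_upper_bound S_sup (S_in e d y d0 gd yd).
have := ge_sup S_sup.1 (S_ub e d y d0 gd yd).
by rewrite ler_norml; lra.
Qed.

Lemma cnorm_ge_Re {R : realType} (z : R[i]) : `|complex.Re z| <= cnorm z.
Proof.
by case: z => a b; rewrite /cnorm /= -sqrtr_sqr ler_wsqrtr// lerDl sqr_ge0.
Qed.

Lemma cnorm_ge_Im {R : realType} (z : R[i]) : `|complex.Im z| <= cnorm z.
Proof.
by case: z => a b; rewrite /cnorm /= -sqrtr_sqr ler_wsqrtr// lerDr sqr_ge0.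
Qed.

Lemma cnorm_le_ReIm {R : realType} (z : R[i]) :
  cnorm z <= `|complex.Re z| + `|complex.Im z|.
Proof.
case: z => a b; rewrite /cnorm /= -(@ger0_norm R (`|a| + `|b|)) ?addr_ge0//.
rewrite -sqrtr_sqr ler_wsqrtr// -(real_normK (num_real a)) -(real_normK (num_real b)).
by have := normr_ge0 a; have := normr_ge0 b; nra.
Qed.

Lemma rat_cauchy_complex {R : realType} (g : rat -> R[i]) (x : R) :
  (forall e : R, 0 < e -> exists2 d : R, 0 < d & forall y z : rat,
     `|ratr y - x| < d -> `|ratr z - x| < d -> cnorm (g y - g z) <= e) ->
  exists L : R[i], forall e : R, 0 < e -> exists2 d : R, 0 < d &
    forall y : rat, `|ratr y - x| < d -> cnorm (g y - L) < e.
Proof.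
move=> gC.
have subRe (u v : R[i]) : complex.Re (u - v) = complex.Re u - complex.Re v.
  by case: u; case: v.
have subIm (u v : R[i]) : complex.Im (u - v) = complex.Im u - complex.Im v.
  by case: u; case: v.
have [|a aL] := rat_cauchy_real (fun y => complex.Re (g y)) x.
  move=> e e0; have [d d0 gd] := gC e e0; exists d => // y z yd zd.
  by rewrite -subRe; apply: le_trans (cnorm_ge_Re _) (gd _ _ yd zd).
have [|b bL] := rat_cauchy_real (fun y => complex.Im (g y)) x.
  move=> e e0; have [d d0 gd] := gC e e0; exists d => // y z yd zd.
  by rewrite -subIm; apply: le_trans (cnorm_ge_Im _) (gd _ _ yd zd).
exists (Complex a b) => e e0; have e30 : 0 < e / 3 by lra.
have [d d0 ad] := aL _ e30; have [d' d'0 bd] := bL _ e30.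
exists (Num.min d d') => [|y]; first by rewrite lt_min d0.
rewrite lt_min => /andP[yd yd'].
apply: le_lt_trans (cnorm_le_ReIm _) _; rewrite subRe subIm /=.
by have := ad y yd; have := bd y yd'; lra.
Qed.

(** * Farey intervals around a real number *)

Definition in_farey {R : realType} (x : R) (p s p' s' : int) : Prop :=
  [/\ 0 < s, 0 < s', p' * s - p * s' = 1,
      p%:~R < s%:~R * x & s'%:~R * x < p'%:~R].

Lemma ratrE {R : realType} (y : rat) :
  ratr y = (numq y)%:~R / (denq y)%:~R :> R.
Proof. by rewrite -{1}[y]divq_num_den fmorph_div /= !ratr_int. Qed.

Lemma in_farey_rat {R : realType} (y : rat) (p s p' s' : int) :
  in_farey (ratr y : R) p s p' s' ->
  0 <= 1 * (numq y * s - p * denq y) /\ 0 <= 1 * (p' * denq y - numq y * s').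
Proof.
have q0 : 0 < (denq y)%:~R :> R by rewrite ltr0z.
case=> _ _ _; rewrite ratrE !mulrA ltr_pdivlMr// ltr_pdivrMr// -!intrM !ltr_int.
lia.
Qed.

(** For one denominator the fractions next to [x] come from a floor and lie at positive distance;
    finitely many denominators leave a positive minimum. *)
Lemma irrational_far {R : realType} (x : R) (N : nat) : ~ is_rational x ->
  exists2 d : R, 0 < d & forall a q : int, 0 < q -> q <= N%:Z ->
    d <= `|x - a%:~R / q%:~R|.
Proof.
move=> xirr; elim: N => [|N [d d0 dN]].
  by exists 1 => // a q q0 q1; lia.
pose b := Num.floor (N.+1%:~R * x).
have N0 : 0 < N.+1%:~R :> R by rewrite ltr0z.
have b1 : b%:~R <= N.+1%:~R * x by exact: floor_le.
have b2 : N.+1%:~R * x < b%:~R + 1 by have := floorD1_gt (N.+1%:~R * x); rewrite intrD.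
have b3 : b%:~R != N.+1%:~R * x.
  apply/eqP => bx; apply: xirr; exists (b%:~R / N.+1%:~R).
  by rewrite fmorph_div /= !ratr_int bx mulrAC divff ?mul1r// gt_eqF.
have b4 : b%:~R < N.+1%:~R * x by rewrite lt_neqAle b3.
exists (Num.min d (Num.min (N.+1%:~R * x - b%:~R) (b%:~R + 1 - N.+1%:~R * x) / N.+1%:~R)).
  by rewrite lt_min d0 divr_gt0// lt_min !subr_gt0 b4 b2.
move=> a q q0 qN; have [q1|q1] := leP q N%:Z; first by rewrite ge_min dN.
have -> : q = N.+1 by lia.
rewrite ge_min ler_pdivrMr//; apply/orP; right.
have -> : `|x - a%:~R / N.+1%:~R| * N.+1%:~R = `|N.+1%:~R * x - a%:~R|.
  by rewrite -{2}(gtr0_norm N0) -normrM mulrBl divfK ?gt_eqF// (mulrC x).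
have [ab|ab] := leP a b.
  have : a%:~R <= b%:~R :> R by rewrite ler_int.
  rewrite ge_min => ab'; apply/orP; left; rewrite ler_normr; apply/orP; left; lra.
have : b%:~R + 1 <= a%:~R :> R by rewrite -[1]/(1%:~R) -intrD ler_int; lia.
rewrite ge_min => ab'; apply/orP; right; rewrite ler_normr; apply/orP; right; lra.
Qed.

(** Mediants are inserted, starting from consecutive integers: an irrational never equals the
    mediant, and each step raises [s + s']. *)
Lemma in_farey_sum_ge {R : realType} (x : R) (N : nat) : ~ is_rational x ->
  exists p s p' s', in_farey x p s p' s' /\ N%:Z <= s + s'.
Proof.
move=> xirr; elim: N => [|N [p [s [p' [s' [[s0 s'0 ps px xp] Ns]]]]]].
  exists (Num.floor x), 1, (Num.floor x + 1), 1; split => //; split => //.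
  - by lia.
  - rewrite mul1r lt_neqAle floor_le andbT; apply/eqP => xE.
    by apply: xirr; exists (Num.floor x)%:~R; rewrite ratr_int.
  - by rewrite mul1r floorD1_gt.
have [xl|xg|xE] := ltgtP ((s + s')%:~R * x) (p + p')%:~R.
- by exists p, s, (p + p'), (s + s'); split; [split => //|]; lia.
- by exists (p + p'), (s + s'), p', s'; split; [split => //|]; lia.
case: xirr; exists ((p + p')%:~R / (s + s')%:~R).
rewrite fmorph_div /= !ratr_int -xE mulrAC divff ?mul1r// intr_eq0; lia.
Qed.

(** Determinant 1 gives the interval length [1 / (s s')]. *)
Lemma in_farey_left {R : realType} (x : R) (p s p' s' : int) :
  in_farey x p s p' s' ->
  0 < x - p%:~R / s%:~R < (s%:~R * s'%:~R)^-1.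
Proof.
case=> s0 s'0 ps px xp.
have sR : 0 < s%:~R :> R by rewrite ltr0z.
have s'R : 0 < s'%:~R :> R by rewrite ltr0z.
have E : p'%:~R * s%:~R - p%:~R * s'%:~R = 1 :> R by rewrite -!intrM -intrB ps.
rewrite subr_gt0 ltr_pdivrMr// (mulrC x) px /= -[ltRHS]mulr1 ltr_pdivlMl ?mulr_gt0//.
rewrite mulrBr.
have -> : s%:~R * s'%:~R * (p%:~R / s%:~R) = p%:~R * s'%:~R :> R.
  by field; rewrite gt_eqF.
nra.
Qed.

Lemma in_farey_right {R : realType} (x : R) (p s p' s' : int) :
  in_farey x p s p' s' ->
  0 < p'%:~R / s'%:~R - x < (s%:~R * s'%:~R)^-1.
Proof.
case=> s0 s'0 ps px xp.
have := @in_farey_left R (- x) (- p') s' (- p) s.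
rewrite !mulrNz mulNr opprK addrC (mulrC s'%:~R); apply; split => //; first lia.
  by rewrite mulrN mulrNz ltrN2.
by rewrite mulrN mulrNz ltrN2.
Qed.

(** An interval shorter than [d] has both endpoints within [d] of [x], which excludes denominators
    up to [N]. *)
Lemma in_farey_large {R : realType} (x : R) (N : nat) : ~ is_rational x ->
  exists p s p' s', [/\ in_farey x p s p' s', N%:Z < s & N%:Z < s'].
Proof.
move=> xirr; have [d d0 dN] := irrational_far x N xirr.
pose M := Num.truncn d^-1.
(* [M.+2] suffices because [s s' >= s + s' - 1] for positive integers. *)
have [p [s [p' [s' [xJ Ms]]]]] := in_farey_sum_ge x M.+2 xirr.
exists p, s, p', s'; split => //; case: (xJ) => s0 s'0 _ _ _.
all: have ssd : (s%:~R * s'%:~R)^-1 < d.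
1,3: rewrite invf_plt ?posrE ?mulr_gt0 ?ltr0z//;
  apply: (lt_le_trans (truncnS_gt _)); rewrite -intrM -[_.+1%:R]/(_.+1%:~R) ler_int;
  by rewrite -/M; nia.
- rewrite ltNge; apply/negP => sN; have := dN p s s0 sN.
  have /andP[x0 x1] := in_farey_left _ _ _ _ _ xJ.
  by rewrite gtr0_norm// leNgt (lt_trans x1).
- rewrite ltNge; apply/negP => sN; have := dN p' s' s'0 sN.
  have /andP[x0 x1] := in_farey_right _ _ _ _ _ xJ.
  by rewrite distrC gtr0_norm// leNgt (lt_trans x1).
Qed.

Lemma in_farey_nbhs {R : realType} (x : R) (p s p' s' : int) :
  in_farey x p s p' s' ->
  exists2 d : R, 0 < d & forall y : R, `|y - x| < d -> in_farey y p s p' s'.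
Proof.
move=> xJ; have /andP[l0 _] := in_farey_left _ _ _ _ _ xJ.
have /andP[r0 _] := in_farey_right _ _ _ _ _ xJ; case: xJ => s0 s'0 ps _ _.
exists (Num.min (x - p%:~R / s%:~R) (p'%:~R / s'%:~R - x)); first by rewrite lt_min l0.
have sR : 0 < s%:~R :> R by rewrite ltr0z.
have s'R : 0 < s'%:~R :> R by rewrite ltr0z.
move=> y; rewrite lt_min !ltr_norml => yx; split => //.
- by rewrite mulrC -ltr_pdivrMr//; lra.
- by rewrite mulrC -ltr_pdivlMr//; lra.
Qed.

(* The Farey interval is the last one in the Stern-Brocot process containing
   the whole ball, so that its mediant is within [t] of [x]. *)
Lemma in_farey_ball {R : realType} (x t : R) (p s p' s' : int) : 0 < t ->
  (forall y, `|y - x| <= t -> in_farey y p s p' s') ->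
  exists P S P' S', (forall y, `|y - x| <= t -> in_farey y P S P' S') /\
    `|x - (P + P')%:~R / (S + S')%:~R| <= t.
Proof.
move=> t0.
have [B tB] : exists B : nat, t^-1 < B%:R.
  by exists (Num.truncn t^-1).+1; exact: truncnS_gt.
have [n] : exists n : nat, B%:Z < s + s' + n.
  by exists (B + `|s| + `|s'|).+1; lia.
elim: n p s p' s' => [|n IH] p s p' s' nB J.
  (* The base case is contradictory: [s + s' > B] makes the interval shorter than [t], yet it
     contains [x - t] and [x]. *)
  have Jx : in_farey x p s p' s' by apply: J; rewrite subrr normr0 ltW.
  have /andP[x1 x2] := in_farey_right _ _ _ _ _ Jx.
  have : in_farey (x - t) p s p' s' by apply: J; rewrite addrAC subrr sub0r normrN gtr0_norm.
  move=> /in_farey_right/andP[_ x3].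
  have [s0 s'0 _ _ _] := Jx.
  have : t^-1 < s%:~R * s'%:~R.
    apply: (lt_le_trans tB); rewrite -intrM -[B%:R]/(B%:~R) ler_int; nia.
  rewrite -[ltLHS]mulr1 -ltr_pdivlMl ?invr_gt0// invrK => x4.
  have : (s%:~R * s'%:~R)^-1 < t by rewrite invf_plt ?posrE ?mulr_gt0 ?ltr0z//; rewrite -[ltLHS]mulr1 -ltr_pdivlMl ?invr_gt0// invrK.
  lra.
have [xt|xt] := leP `|x - (p + p')%:~R / (s + s')%:~R| t.
  by exists p, s, p', s'.
have [s0 s'0 ps _ _] : in_farey x p s p' s' by apply: J; rewrite subrr normr0 ltW.
have ssR : 0 < (s + s')%:~R :> R by rewrite ltr0z addr_gt0.
(* The mediant is outside the ball, so the ball lies in one of the two halves. *)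
have [xl|xg] := leP ((p + p')%:~R / (s + s')%:~R) x.
- move: xt; rewrite ger0_norm ?subr_ge0// => xt.
  apply: (IH (p + p') (s + s') p' s'); first lia.
  move=> y yx; have [_ _ _ yp py] := J y yx; split => //; [lia|lia|].
  by move: yx; rewrite mulrC -ltr_pdivrMr// ler_norml; lra.
- move: xt; rewrite ltr0_norm ?subr_lt0// => xt.
  apply: (IH p s (p + p') (s + s')); first lia.
  move=> y yx; have [_ _ _ yp py] := J y yx; split => //; [lia|lia|].
  by move: yx; rewrite mulrC -ltr_pdivlMr// ler_norml; lra.
Qed.

(** * The extension and its continuity *)

Lemma powRN_small {R : realType} (r K e : R) : 0 < r -> 0 <= K -> 0 < e ->
  exists N : nat, forall m : int, N%:Z < m -> K * m%:~R `^ (- r) < e.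
Proof.
move=> r0 K0 e0; have K10 : 0 < (K + 1) / e by rewrite divr_gt0// ltr_wpDl.
exists (Num.truncn (((K + 1) / e) `^ r^-1)).+1 => m Nm.
have m0 : 0 < m by lia.
have : ((K + 1) / e) `^ r^-1 < m%:~R.
  by apply: (lt_trans (truncnS_gt _)); rewrite -[_.+1%:R]/(_.+1%:~R) ltr_int.
move=> /(gt0_ltr_powR r0); rewrite !nnegrE powR_ge0 ler0z (ltW m0) => /(_ isT isT).
rewrite -powRrM mulVf ?gt_eqF// powRr1 ?(ltW K10)// ltr_pdivrMr// => H.
rewrite powRN ltr_pdivrMr ?powR_gt0 ?ltr0z// mulrC.
by apply: lt_trans H; rewrite ltrDl.
Qed.

Section Extension.
Context {R : realType} (k : R[i]) (f : rat -> R[i]) (h : R -> R[i]).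
Hypothesis k0 : 0 < complex.Re k.
Hypothesis f_per : forall x, f (x + 1) = f x.
Hypothesis fh : forall x : rat, x != 0 ->
  h (ratr x) = f x - cpow `|ratr x| (- k) * f (- x^-1).
Context (C : R).
Hypothesis h_bigO : forall x : R, 0 < `|x| <= 1 ->
  cnorm (h x) <= C * `|x| `^ (- complex.Re k).

Let kap := complex.Re k.
Let K := C / (1 - 2 `^ (- kap)) + C.

Let K_ge0 : 0 <= K.
Proof.
have C0 : 0 <= C by exact: bigO_const_ge0 h_bigO.
by rewrite addr_ge0// divr_ge0// subr_ge0 ltW// two_powRN_lt1.
Qed.

Lemma fstar_farey_rat_le (e p s p' s' m : int) (y : rat) :
  e * e = 1 -> 0 < m -> m <= s -> m <= s' -> p' * s - p * s' = e ->
  0 <= e * (numq y * s - p * denq y) -> 0 <= e * (p' * denq y - numq y * s') ->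
  cnorm (fstar_rat k f y - fstar_rat k f (p%:~R / s%:~R))
    <= K * m%:~R `^ (- kap).
Proof.
move=> ee m0 ms ms' pp yp py; rewrite -{1}[y]divq_num_den.
apply: (fstar_farey_le k f h k0 f_per fh C h_bigO e p s p' s' m) => //.
exact: coprime_num_den.
Qed.

Lemma fstar_in_farey_le (p s p' s' m : int) (y z : rat) :
  in_farey (ratr y : R) p s p' s' -> in_farey (ratr z : R) p s p' s' ->
  0 < m -> m <= s -> m <= s' ->
  cnorm (fstar_rat k f y - fstar_rat k f z) <= 2 * K * m%:~R `^ (- kap).
Proof.
move=> yJ zJ m0 ms ms'; have [_ _ pp _ _] := yJ.
have [y1 y2] := in_farey_rat _ _ _ _ _ yJ.
have [z1 z2] := in_farey_rat _ _ _ _ _ zJ.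
have Y := fstar_farey_rat_le 1 p s p' s' m y erefl m0 ms ms' pp y1 y2.
have Z := fstar_farey_rat_le 1 p s p' s' m z erefl m0 ms ms' pp z1 z2.
apply: le_trans (cnorm_dist (fstar_rat k f (p%:~R / s%:~R)) _ _) _.
by rewrite (cnormB (fstar_rat k f (p%:~R / s%:~R))); lra.
Qed.

(** The value is chosen point by point; at an irrational it exists by completeness, as Farey
    intervals with large denominators carry small oscillation. *)
Lemma fstar_extension : exists F : R -> R[i],
  (forall y : rat, F (ratr y) = fstar_rat k f y) /\
  (forall x : R, ~ is_rational x ->
     forall e : R, 0 < e -> exists2 d : R, 0 < d &
       forall y : rat, `|ratr y - x| < d ->
         cnorm (fstar_rat k f y - F x) < e).
Proof.
suff /choice[F FP] : forall x : R, exists L : R[i],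
    (forall y : rat, ratr y = x -> L = fstar_rat k f y) /\
    (~ is_rational x -> forall e : R, 0 < e -> exists2 d : R, 0 < d &
       forall y : rat, `|ratr y - x| < d -> cnorm (fstar_rat k f y - L) < e).
  by exists F; split => [y|x]; [apply: (FP _).1|apply: (FP x).2].
move=> x; have [[y <-]|xirr] := pselect (is_rational x).
  exists (fstar_rat k f y); split => [z /fmorph_inj -> //|].
  by case; exists y.
have [|L LP] := rat_cauchy_complex (fstar_rat k f) x.
  move=> e e0; have [N NP] := powRN_small kap (2 * K) e k0 (mulr_ge0 (ler0n _ 2) K_ge0) e0.
  have [p [s [p' [s' [xJ Ns Ns']]]]] := in_farey_large x N xirr.
  have [d d0 dJ] := in_farey_nbhs _ _ _ _ _ xJ.
  exists d => // y z yd zd.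
  apply: ltW; apply: le_lt_trans (NP (N%:Z + 1) _); last by lia.
  by apply: fstar_in_farey_le (dJ _ yd) (dJ _ zd) _ _ _; lia.
exists L; split => // y yx; case: xirr; by exists y.
Qed.

(** * Continuity at irrational and at rational points *)

Section Regularity.
Context (F : R -> R[i]).
Hypothesis F_rat : forall y : rat, F (ratr y) = fstar_rat k f y.
Hypothesis F_lim : forall x : R, ~ is_rational x ->
  forall e : R, 0 < e -> exists2 d : R, 0 < d &
    forall y : rat, `|ratr y - x| < d -> cnorm (fstar_rat k f y - F x) < e.

(** Transfers estimates from the rationals to [F]; at a rational point the point itself serves. *)
Lemma fstar_approx (x e d : R) : 0 < e -> 0 < d ->
  exists2 y : rat, `|ratr y - x| < d & cnorm (fstar_rat k f y - F x) < e.
Proof.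
move=> e0 d0; have [[y <-]|xirr] := pselect (is_rational x).
  by exists y; rewrite ?F_rat subrr ?normr0 ?cnorm0.
have [d' d'0 dP] := F_lim x xirr e e0.
have [y] := rat_near x (Num.min d d') ltac:(by rewrite lt_min d0).
by rewrite lt_min => /andP[yd yd']; exists y => //; apply: dP.
Qed.

Lemma fstar_osc (p s p' s' m : int) (x y : R) :
  in_farey x p s p' s' -> in_farey y p s p' s' -> 0 < m -> m <= s -> m <= s' ->
  cnorm (F x - F y) <= 2 * K * m%:~R `^ (- kap).
Proof.
move=> xJ yJ m0 ms ms'; apply/ler_addgt0Pr => e e0.
have [d d0 dJ] := in_farey_nbhs _ _ _ _ _ xJ.
have [d' d'0 d'J] := in_farey_nbhs _ _ _ _ _ yJ.
have e20 : 0 < e / 2 by lra.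
have [x' x'd x'e] := fstar_approx x (e / 2) d e20 d0.
have [y' y'd y'e] := fstar_approx y (e / 2) d' e20 d'0.
have xy := fstar_in_farey_le p s p' s' m x' y' (dJ _ x'd) (d'J _ y'd) m0 ms ms'.
have := cnorm_dist (fstar_rat k f x') (F x) (F y).
have := cnorm_dist (fstar_rat k f y') (fstar_rat k f x') (F y).
rewrite (cnormB (F x) (fstar_rat k f x')); lra.
Qed.

Lemma fstar_cont_irrational (x : R) : ~ is_rational x -> ccont_at F x.
Proof.
move=> xirr e e0.
have [N NP] := powRN_small kap (2 * K) e k0 (mulr_ge0 (ler0n _ 2) K_ge0) e0.
have [p [s [p' [s' [xJ Ns Ns']]]]] := in_farey_large x N xirr.
have [d d0 dJ] := in_farey_nbhs _ _ _ _ _ xJ.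
exists d => // y yd; apply: le_lt_trans (NP (N%:Z + 1) _); last by lia.
by apply: fstar_osc (dJ _ yd) xJ _ _ _; lia.
Qed.

Hypothesis h_littleo : forall e : R, 0 < e -> exists2 d : R, 0 < d &
  forall x : R, 0 < `|x| < d -> cnorm (h x) <= e * `|x| `^ (- complex.Re k).

(* With [p'/s'] a Farey neighbour of [p/s], a rational [y] close to [p/s] on the
   same side lies between two consecutive neighbours [(p' + n p)/(s' + n s)]
   and [(p' + (n+1) p)/(s' + (n+1) s)], where [n] is the quotient below. *)
Lemma fstar_side_cont (e p s : int) (eps : R) :
  e * e = 1 -> 0 < s -> coprimez p s -> 0 < eps ->
  exists2 d : R, 0 < d & forall y : rat, 0 < e * (numq y * s - p * denq y) ->
    `|ratr y - p%:~R / s%:~R| < d ->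
    cnorm (fstar_rat k f y - fstar_rat k f (p%:~R / s%:~R)) <= eps.
Proof.
move=> ee s0 /coprimezP[[u0 v0] /= uv] eps0.
have eE : e = 1 \/ e = -1 by nia.
have [p' [s' [s'0 pp]]] : exists p' s' : int, 0 < s' /\ p' * s - p * s' = e.
  (* A Bezout pair gives a neighbour; adding [|u0| + 1] copies of [(p, s)] makes its denominator
     positive. *)
  exists (e * v0 + (`|u0|%N%:Z + 1) * p), (- e * u0 + (`|u0|%N%:Z + 1) * s); split.
    have : `|u0|%N%:Z + 1 <= (`|u0|%N%:Z + 1) * s by rewrite ler_peMr; lia.
    by case: eE => ->; lia.
  by rewrite -[RHS]mulr1 -uv; ring.
have sR : 0 < s%:~R :> R by rewrite ltr0z.
have sk0 : 0 < s%:~R `^ (- kap) :> R by rewrite powR_gt0.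
(* [c] is scaled so that the jump bound [c s ^ (- kap)] equals [eps / 2]. *)
pose c := eps / 2 / s%:~R `^ (- kap).
have c0 : 0 < c by rewrite !divr_gt0.
have [dl dl0 hdl] := h_littleo c c0.
have [N NP] := powRN_small kap K (eps / 2) k0 K_ge0 ltac:(lra).
(* [N] controls the oscillation between consecutive neighbours; the second term puts the argument of
   [h], of size [s / (s' + n s)], below [dl]. *)
pose N' := maxn N (Num.truncn (dl / 2)^-1).+1.
have NN' : (N <= N')%N by rewrite leq_max leqnn.
have dlN : 1 <= dl / 2 * N'%:R.
  have : (dl / 2)^-1 < N'%:R.
    by apply: (lt_le_trans (truncnS_gt _)); rewrite ler_nat leq_max leqnn orbT.
  by rewrite -[ltLHS]mulr1 ltr_pdivrMl ?divr_gt0// => /ltW.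
have N'0 : (0 < N')%N by rewrite leq_max orbT.
clearbody N'.
have S0 : 0 < s' + N'%:Z * s by nia.
(* This is the distance from [p/s] to its neighbour of index [N'], so any closer [y] on that side
   has [n >= N']. *)
exists (s%:~R * (s' + N'%:Z * s)%:~R)^-1; first by rewrite invr_gt0 mulr_gt0// ltr0z.
move=> y; set b := numq y; set q := denq y => u_gt0 yd.
have q0 : 0 < q by exact: denq_gt0.
set u := e * (b * s - p * q) in u_gt0; pose v := e * (p' * q - b * s').
have vu : N'%:Z * u <= v.
  have uq : u * (s' + N'%:Z * s) < q.
    have qR : 0 < q%:~R :> R by rewrite ltr0z.
    have uE : u%:~R = `|ratr y - p%:~R / s%:~R| * (s%:~R * q%:~R) :> R.
      have -> : ratr y - p%:~R / s%:~R = (b * s - p * q)%:~R / (s%:~R * q%:~R) :> R.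
        rewrite ratrE -/b -/q intrB !intrM; field; by rewrite !gt_eqF.
      rewrite normrM normfV (gtr0_norm (mulr_gt0 sR qR)) divfK ?gt_eqF ?mulr_gt0//.
      have -> : u = `|b * s - p * q|.
        have [e1|e1] := eE.
          by move: u_gt0; rewrite /u e1 mul1r => ?; rewrite gtr0_norm.
        by move: u_gt0; rewrite /u e1 mulN1r oppr_gt0 => ?; rewrite ltr0_norm.
      by rewrite intr_norm.
    have : `|ratr y - p%:~R / s%:~R| * (s%:~R * (s' + N'%:Z * s)%:~R) < 1 :> R.
      by rewrite -ltr_pdivlMr ?mulr_gt0 ?ltr0z// div1r.
    rewrite -(ltr_pM2r qR) => H; rewrite -(ltr_int R) intrM uE.
    by move: H; rewrite mul1r; apply: le_lt_trans; rewrite le_eqVlt; apply/orP; left; apply/eqP; ring.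
  have : s * (v - N'%:Z * u) = q - u * (s' + N'%:Z * s).
    transitivity (e * (p' * s - p * s') * q - u * (s' + N'%:Z * s)).
      by rewrite /v /u; ring.
    by rewrite pp ee mul1r.
  by move=> E; rewrite -subr_ge0 -(pmulr_rge0 _ s0) E subr_ge0 ltW.
pose n := (v %/ u)%Z.
have nN : N'%:Z <= n by rewrite lez_divRL.
have nv : n * u <= v by exact: lez_floor (lt0r_neq0 u_gt0).
have vn : v < (n + 1) * u by exact: ltz_ceil.
have NS : N'%:Z * s <= n * s by rewrite ler_wpM2r// ltW.
have nS : N'%:Z < s' + n * s.
  have : N'%:Z <= N'%:Z * s by rewrite ler_peMr.
  by lia.
have S_gt0 : 0 < s' + n * s by apply: le_lt_trans nS.
have SS : s' + n * s <= s' + (n + 1) * s by rewrite lerD2l ler_wpM2r ?(ltW s0)// lerDl.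
have eeN : - e * - e = 1 by rewrite mulrNN.
have NNS : N%:Z < s' + n * s by apply: le_lt_trans nS; rewrite lez_nat.
(* The sign is [- e] because the neighbours move toward [p/s] as [n] grows. *)
have := fstar_farey_rat_le (- e) (p' + n * p) (s' + n * s)
  (p' + (n + 1) * p) (s' + (n + 1) * s) (s' + n * s) y.
have yP : 0 <= - e * (numq y * (s' + n * s) - (p' + n * p) * denq y).
  rewrite -/b -/q; have -> : - e * (b * (s' + n * s) - (p' + n * p) * q) = v - n * u.
    by rewrite /v /u; ring.
  by rewrite subr_ge0.
have Py : 0 <= - e * ((p' + (n + 1) * p) * denq y - numq y * (s' + (n + 1) * s)).
  rewrite -/b -/q; have -> : - e * ((p' + (n + 1) * p) * q - b * (s' + (n + 1) * s)) =
    (n + 1) * u - v by rewrite /v /u; ring.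
  by rewrite subr_ge0 ltW.
move=> /(_ eeN S_gt0 (lexx _) SS _ yP Py).
move=> /(_ ltac:(rewrite -pp; ring)) H1.
have H2 : cnorm (fstar_rat k f (p%:~R / s%:~R) -
    fstar_rat k f ((p' + n * p)%:~R / (s' + n * s)%:~R)) <= c * s%:~R `^ (- kap).
  apply: (fstar_nbr_le k f h f_per fh c (dl / 2) e) => //.
  - by move=> x /andP[x0 xd]; apply: hdl; rewrite x0 (le_lt_trans xd)//; lra.
  - by rewrite -pp; ring.
  - rewrite -[leLHS]mul1r; apply: le_trans (ler_wpM2r (ltW sR) dlN) _.
    rewrite -(mulrA (dl / 2)) ler_pM2l; last by lra.
    by rewrite -[N'%:R]/(N'%:~R) -intrM ler_int; apply: le_trans NS _; rewrite lerDr ltW.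
have H3 : K * (s' + n * s)%:~R `^ (- kap) < eps / 2 by exact: NP.
move: H2; rewrite /c divfK ?gt_eqF// => H2.
apply: le_trans (cnorm_dist (fstar_rat k f ((p' + n * p)%:~R / (s' + n * s)%:~R)) _ _) _.
by rewrite (cnormB _ (fstar_rat k f (p%:~R / s%:~R))); lra.
Qed.

Lemma fstar_cont_rational (x : rat) : ccont_at F (ratr x).
Proof.
move=> e e0; have e30 : 0 < e / 3 by lra.
have cop : coprimez (numq x) (denq x) by exact: coprime_num_den.
have [d d0 dP] := fstar_side_cont 1 (numq x) (denq x) _ erefl (denq_gt0 x) cop e30.
have [d' d'0 d'P] := fstar_side_cont (-1) (numq x) (denq x) _ erefl (denq_gt0 x) cop e30.
exists (Num.min d d') => [|z zx]; first by rewrite lt_min d0.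
have [y yz ye] := fstar_approx z (e / 3) (Num.min d d' - `|z - ratr x|) e30
  ltac:(by rewrite subr_gt0).
have : `|ratr y - (numq x)%:~R / (denq x)%:~R| < Num.min d d'.
  by rewrite -ratrE; have := ler_distD z (ratr y) (ratr x); lra.
rewrite lt_min => /andP[yd yd'].
have yx : cnorm (fstar_rat k f y - fstar_rat k f x) <= e / 3.
  rewrite -{1}[x]divq_num_den.
  have [s_gt0|s_lt0|s_eq0] := ltgtP 0 (numq y * denq x - numq x * denq y).
  - by apply: dP; rewrite ?mul1r.
  - by apply: d'P; rewrite ?mulN1r ?oppr_gt0.
  - have -> : y = (numq x)%:~R / (denq x)%:~R.
      rewrite -[LHS]divq_num_den; apply: eq_intfrac; rewrite ?denq_gt0//; lia.
    by rewrite subrr cnorm0 ltW.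
have := cnorm_dist (fstar_rat k f y) (F z) (fstar_rat k f x).
by rewrite F_rat (cnormB (F z) (fstar_rat k f y)); lra.
Qed.

End Regularity.
End Extension.

(** * Hoelder regularity at Diophantine points *)

(** For [c > 0] this bounds the irrationality exponent of [x] by [2 + eta]. *)
Definition diophantine_with {R : realType} (eta c x : R) : Prop :=
  forall a q : int, 0 < q ->
    c * q%:~R `^ (- (2 + eta)) <= `|x - a%:~R / q%:~R|.

Definition diophantine {R : realType} (eta x : R) : Prop :=
  exists2 c : R, 0 < c & diophantine_with eta c x.

Lemma diophantine_irrational {R : realType} (eta x : R) :
  diophantine eta x -> ~ is_rational x.
Proof.
case=> c c0 cx [y yx]; have := cx (numq y) (denq y) (denq_gt0 y).
rewrite -yx ratrE subrr normr0 leNgt mulr_gt0// powR_gt0//.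
by rewrite ltr0z.
Qed.

(** Each endpoint is within [1 / (s s')] of [x] but no nearer than the Diophantine bound allows;
    comparing the two limits how unequal the denominators can be. *)
Lemma diophantine_farey {R : realType} (eta c x : R) (p s p' s' : int) :
  diophantine_with eta c x -> in_farey x p s p' s' ->
  c * s'%:~R <= s%:~R `^ (1 + eta) /\ c * s%:~R <= s'%:~R `^ (1 + eta).
Proof.
move=> cx xJ; have [s0 s'0 _ _ _] := xJ.
have sR : 0 < s%:~R :> R by rewrite ltr0z.
have s'R : 0 < s'%:~R :> R by rewrite ltr0z.
have aux (u v D : R) : 0 < u -> 0 < v -> c * u `^ (- (2 + eta)) <= D ->
    D < (u * v)^-1 -> c * v <= u `^ (1 + eta).
  move=> u0 v0 cD Duv; have := le_lt_trans cD Duv; set T := u `^ (1 + eta).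
  have T0 : 0 < T by rewrite powR_gt0.
  have -> : u `^ (- (2 + eta)) = (u * T)^-1.
    rewrite powRN; congr (_^-1); rewrite -{2}(powRr1 (ltW u0)) -powRD.
      by congr (_ `^ _); ring.
    by rewrite (gt_eqF u0) implybT.
  rewrite ltr_pdivrMr ?mulr_gt0// invfM -mulrA.
  have -> : u^-1 * (v^-1 * (u * T)) = v^-1 * T by field; rewrite !gt_eqF.
  by rewrite ltr_pdivlMl// mulrC => /ltW.
have /andP[l0 l1] := in_farey_left _ _ _ _ _ xJ.
have /andP[r0 r1] := in_farey_right _ _ _ _ _ xJ.
split; [apply: (aux _ _ _ sR s'R _ l1)|apply: (aux _ _ (p'%:~R / s'%:~R - x) s'R sR)].
- by rewrite -(gtr0_norm l0); exact: cx.
- by rewrite -(gtr0_norm r0) distrC; exact: cx.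
- by rewrite (mulrC s'%:~R).
Qed.

Section Hoelder.
Context {R : realType} (k : R[i]) (f : rat -> R[i]) (h : R -> R[i]).
Hypothesis k0 : 0 < complex.Re k.
Hypothesis f_per : forall x, f (x + 1) = f x.
Hypothesis fh : forall x : rat, x != 0 ->
  h (ratr x) = f x - cpow `|ratr x| (- k) * f (- x^-1).
Context (C : R).
Hypothesis h_bigO : forall x : R, 0 < `|x| <= 1 ->
  cnorm (h x) <= C * `|x| `^ (- complex.Re k).
Context (F : R -> R[i]).
Hypothesis F_rat : forall y : rat, F (ratr y) = fstar_rat k f y.
Hypothesis F_lim : forall x : R, ~ is_rational x ->
  forall e : R, 0 < e -> exists2 d : R, 0 < d &
    forall y : rat, `|ratr y - x| < d -> cnorm (fstar_rat k f y - F x) < e.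

Let kap := complex.Re k.
Let K := C / (1 - 2 `^ (- kap)) + C.

(** The mediant, of denominator [q = S + S'], lies within [t] of [x], so [t >= c q ^ (- (2 + eta))];
    as [q] is at most of order [m ^ (1 + eta)], this bounds [m ^ (- kap)] by a multiple of
    [t ^ alpha]. *)
Lemma fstar_holder (eta alpha x : R) : 0 < eta -> 0 < alpha ->
  alpha * ((1 + eta) * (2 + eta)) <= kap -> diophantine eta x ->
  holder_at F alpha x.
Proof.
move=> eta0 alpha0 ak xD; have xirr := diophantine_irrational eta x xD.
case: xD => c c0 cx.
have C0 : 0 <= C by exact: bigO_const_ge0 h_bigO.
have K0 : 0 <= K.
  by rewrite addr_ge0// divr_ge0// subr_ge0 ltW// two_powRN_lt1.
have [p [s [p' [s' [xJ _ _]]]]] := in_farey_large x 0 xirr.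
have [d d0 dJ] := in_farey_nbhs _ _ _ _ _ xJ.
(* [b] collects the constants from replacing [m ^ (1 + eta)] by [c q / 2] and [q ^ (- (2 + eta))] by
   [t / c]. *)
pose b := (c / 2) `^ (- (alpha * (2 + eta))) * (c^-1) `^ alpha.
exists (2 * K * b), d => // y yd.
have [->|yx] := eqVneq y x.
  by rewrite subrr cnorm0 !mulr_ge0 ?powR_ge0.
set t := `|y - x|; have t0 : 0 < t by rewrite normr_gt0 subr_eq0.
have [|P [S [P' [S' [SJ med]]]]] := in_farey_ball x t p s p' s' t0.
  by move=> z zt; apply: dJ; apply: le_lt_trans zt yd.
have xS : in_farey x P S P' S' by apply: SJ; rewrite subrr normr0 ltW.
have yS : in_farey y P S P' S' by apply: SJ.
have [S0 S'0 _ _ _] := xS.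
have [cS cS'] := diophantine_farey eta c x P S P' S' cx xS.
pose m := Num.min S S'; pose q := S + S'.
have mS : m <= S by rewrite ge_min lexx.
have mS' : m <= S' by rewrite ge_min lexx orbT.
have m0 : 0 < m by rewrite lt_min S0.
have q0 : 0 < q by rewrite addr_gt0.
have mR0 : 0 < m%:~R :> R by rewrite ltr0z.
have qR0 : 0 < q%:~R :> R by rewrite ltr0z.
apply: le_trans (fstar_osc k f h k0 f_per fh C h_bigO F F_rat F_lim P S P' S' m y x yS xS m0 mS mS') _.
rewrite -(mulrA (2 * K)); apply: ler_wpM2l; first by rewrite mulr_ge0.
have cq : c / 2 * q%:~R <= m%:~R `^ (1 + eta).
  have qE : q%:~R = S%:~R + S'%:~R :> R by rewrite intrD.
  rewrite qE /m; case: (leP S S') => SS.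
    have : S%:~R <= S'%:~R :> R by rewrite ler_int.
    by move=> /(ler_wpM2l (ltW c0)); lra.
  have : S'%:~R <= S%:~R :> R by rewrite ler_int ltW.
  by move=> /(ler_wpM2l (ltW c0)); lra.
have qt : q%:~R `^ (- (2 + eta)) <= c^-1 * t.
  by rewrite ler_pdivlMl//; apply: le_trans med; exact: cx.
have m1 : 1 <= m%:~R :> R by rewrite ler1z -gtz0_ge1.
have le1 : m%:~R `^ (- kap) <= (m%:~R `^ (1 + eta)) `^ (- (alpha * (2 + eta))) :> R.
  by rewrite -powRrM; apply: ler_powR => //; nra.
apply: le_trans le1 _.
have cq0 : 0 < c / 2 * q%:~R by rewrite mulr_gt0// divr_gt0.
have a20 : 0 <= alpha * (2 + eta) by rewrite mulr_ge0; lra.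
apply: le_trans (ge0_powRN_le _ _ _ a20 cq0 cq) _.
rewrite powRM; [|by rewrite ltW// divr_gt0|exact: ltW].
rewrite /b -mulrA; apply: ler_wpM2l; first exact: powR_ge0.
have -> : - (alpha * (2 + eta)) = - (2 + eta) * alpha by ring.
have ci0 : 0 <= c^-1 by rewrite invr_ge0 ltW.
rewrite powRrM -powRM ?(ltW t0)//; apply: ge0_ler_powR => //; first exact: ltW.
- by rewrite nnegrE powR_ge0.
- by rewrite nnegrE mulr_ge0// ltW.
Qed.

End Hoelder.

(** * Diophantine points have full measure *)

(* Telescoping, from [ln (1 + 1/m) >= 1/(m+1)]. *)
Lemma powRN_telescope {R : realType} (eta : R) (m : nat) : 0 < eta ->
  m.+1%:R `^ (- (1 + eta)) <=
    (2 + eta) / eta * (m.+1%:R `^ (- eta) - m.+2%:R `^ (- eta)) :> R.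
Proof.
move=> eta0; set u : R := m.+1%:R.
have u1 : 1 <= u by rewrite ler1n.
have u0 : 0 < u by lra.
have -> : m.+2%:R = u + 1 :> R by rewrite /u natr1.
set r := u / (u + 1).
have r0 : 0 < r by rewrite divr_gt0// addr_gt0.
have ue0 : 0 < u `^ (- eta) by rewrite powR_gt0.
have -> : u `^ (- (1 + eta)) = u `^ (- eta) / u.
  rewrite opprD addrC powRD ?(gt_eqF u0) ?implybT//.
  by rewrite powR_inv1// ltW.
have -> : (u + 1) `^ (- eta) = u `^ (- eta) * r `^ eta.
  have -> : r = u * (u + 1)^-1 by [].
  rewrite powRM ?invr_ge0 ?addr_ge0// ?ltW// mulrA -powRD ?addNr ?eqxx ?(gt_eqF u0)//.
  by rewrite powRr0 mul1r -powR_inv1 ?addr_ge0 ?ltW// -powRrM mulN1r.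
(* [ln r <= - 1 / (u + 1)] and [exp z >= 1 + z] give [r ^ (- eta) >= 1 + eta / (u + 1)]. *)
have rle : r `^ eta <= (u + 1) / (u + 1 + eta).
  have lnr : ln r <= - (u + 1)^-1.
    have -> : r = 1 + - (u + 1)^-1 by rewrite /r; field; lra.
    by apply: le_ln1Dx; rewrite ltrN2 invf_lt1; lra.
  have E1 : r `^ eta * (1 + eta / (u + 1)) <= 1.
    rewrite /powR gt_eqF//.
    have H : 1 + eta / (u + 1) <= expR (- (eta * ln r)).
      apply: le_trans (expR_ge1Dx _); rewrite lerD2l -mulrN; apply: ler_wpM2l; lra.
    apply: le_trans (ler_wpM2l (expR_ge0 _) H) _.
    by rewrite -expRD subrr expR0.
  rewrite ler_pdivlMr; last by lra.
  have -> : u + 1 + eta = (1 + eta / (u + 1)) * (u + 1) by field; lra.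
  by rewrite mulrA -[leRHS]mul1r; apply: ler_wpM2r; lra.
rewrite -[X in X - _]mulr1 -mulrBr mulrCA; apply: ler_wpM2l; first exact: ltW.
apply: le_trans (_ : (2 + eta) / eta * (1 - (u + 1) / (u + 1 + eta)) <= _); last first.
  by apply: ler_wpM2l; [apply: divr_ge0; lra|lra].
(* It remains that [(2 + eta) u >= u + 1 + eta], with equality at [u = 1]; hence the constant
   [2 + eta]. *)
have -> : (2 + eta) / eta * (1 - (u + 1) / (u + 1 + eta)) = (2 + eta) / (u + 1 + eta).
  by field; lra.
rewrite -[leLHS]mul1r ler_pdivlMr; last by lra.
by rewrite mulrAC ler_pdivrMr//; nra.
Qed.

Lemma powRN_sum_le {R : realType} (eta : R) (n : nat) : 0 < eta ->
  \sum_(i < n) i.+1%:R `^ (- (1 + eta)) <= (2 + eta) / eta :> R.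
Proof.
move=> eta0.
have K0 : 0 <= (2 + eta) / eta by rewrite divr_ge0; lra.
suff : \sum_(i < n) i.+1%:R `^ (- (1 + eta)) <=
    (2 + eta) / eta * (1 - n.+1%:R `^ (- eta)) :> R.
  by move=> H; apply: (le_trans H); apply: ler_piMr; rewrite ?gerBl ?powR_ge0.
elim: n => [|n IH]; first by rewrite big_ord0 powR1 subrr mulr0.
rewrite big_ord_recr /=; apply: le_trans (lerD IH (powRN_telescope eta n eta0)) _.
by rewrite -mulrDr subrKA.
Qed.

Section Null.
Import numFieldNormedType.Exports.
Context {R : realType} (eta : R).
Hypothesis eta0 : 0 < eta.

Local Notation mu := (@lebesgue_measure R).

(* The balls of [cover M n q] surround the fractions [a / (q + 1)] with
   [|a| <= (M + 1) (q + 1)], enumerated by [j = a + (M + 1) (q + 1)]. *)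
Let center (M q j : nat) : R := (j%:Z - (M.+1 * q.+1)%N%:Z)%:~R / q.+1%:Z%:~R.
Let ncenter (M q : nat) : nat := (2 * (M.+1 * q.+1)).+1.
Let cover (M n q : nat) : set R :=
  \big[setU/set0]_(j < ncenter M q)
    ball (center M q j) (q.+1%:R `^ (- (2 + eta)) / n.+1%:R).

Let cover_measurable M n q : measurable (cover M n q).
Proof. by apply: bigsetU_measurable => j _; exact: measurable_realfun.measurable_ball. Qed.

(** There are [2 (M + 1) (q + 1) + 1] balls; the factor [q + 1] turns the exponent [2 + eta] into
    the summable [1 + eta]. *)
Let cover_le M n q : (mu (cover M n q) <=
  ((2 * M.+1).+1%:R * 2 / n.+1%:R * q.+1%:R `^ (- (1 + eta)))%:E)%E.
Proof.
have mb (j : nat) : (j < ncenter M q)%N -> measurable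
    (ball (center M q j) (q.+1%:R `^ (- (2 + eta)) / n.+1%:R) : set R).
  by move=> _; exact: measurable_realfun.measurable_ball.
apply: le_trans (Boole_inequality mu mb) _.
set w' := _ `^ _ / n.+1%:R in mb *.
have w'0 : 0 <= w' by rewrite divr_ge0// powR_ge0.
rewrite (eq_bigr (fun=> (w' *+ 2)%:E)); last first.
  by move=> j _; exact: lebesgue_measure_ball.
rewrite sumEFin lee_fin sumr_const card_ord.
have q0 : 0 < q.+1%:R :> R by rewrite ltr0n.
have -> : q.+1%:R `^ (- (1 + eta)) = q.+1%:R `^ (- (2 + eta)) * q.+1%:R :> R.
  have -> : - (1 + eta) = - (2 + eta) + 1 by ring.
  by rewrite powRD ?powRr1 ?(ltW q0)// (gt_eqF q0) implybT.
rewrite /w'; set w := _ `^ _; have w0 : 0 <= w by exact: powR_ge0.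
have nc : (ncenter M q)%:R <= (2 * M.+1).+1%:R * q.+1%:R :> R.
  by rewrite -natrM ler_nat /ncenter; lia.
rewrite -[leLHS]mulr_natr.
have -> : (2 * M.+1).+1%:R * 2 / n.+1%:R * (w * q.+1%:R) =
  w / n.+1%:R *+ 2 * ((2 * M.+1).+1%:R * q.+1%:R) by rewrite -mulr_natr; ring.
by apply: ler_wpM2l => //; rewrite mulrn_wge0// divr_ge0.
Qed.

Let cover_union_le M n : (mu (\bigcup_q cover M n q) <=
  ((2 * M.+1).+1%:R * 2 * ((2 + eta) / eta) / n.+1%:R)%:E)%E.
Proof.
apply: le_trans (generalized_Boole_inequality mu (cover_measurable M n) _) _.
  by apply: bigcupT_measurable => q; exact: cover_measurable.
apply: lime_le; first by apply: is_cvg_nneseries => q _ _; exact: measure_ge0.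
apply: nearW => m; rewrite big_mkord.
apply: (le_trans (lee_sum _ (fun (q : 'I_m) _ => cover_le M n q))).
rewrite sumEFin lee_fin -mulr_sumr.
have -> : (2 * M.+1).+1%:R * 2 * ((2 + eta) / eta) / n.+1%:R =
  (2 * M.+1).+1%:R * 2 / n.+1%:R * ((2 + eta) / eta) :> R by ring.
apply: ler_wpM2l; first by rewrite divr_ge0// mulr_ge0.
exact: powRN_sum_le.
Qed.

Let cover_null M : mu.-negligible (\bigcap_n \bigcup_q cover M n q).
Proof.
have mU n : measurable (\bigcup_q cover M n q) by apply: bigcupT_measurable => q; exact: cover_measurable.
exists (\bigcap_n \bigcup_q cover M n q); split => //; first exact: bigcapT_measurable.
apply/eqP; rewrite -measure_le0; apply/lee_addgt0Pr => e e0; rewrite add0e.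
pose D : R := (2 * M.+1).+1%:R * 2 * ((2 + eta) / eta).
have D0 : 0 < D.
  by apply: mulr_gt0; [rewrite mulr_gt0 ?ltr0n|rewrite divr_gt0// addr_gt0].
pose n := Num.truncn (D / e).
apply: (@le_trans _ _ (mu (\bigcup_q cover M n q))).
  apply: le_measure; rewrite ?inE; [exact: bigcapT_measurable|exact: mU|].
  by move=> x xU; apply: xU.
apply: (le_trans (cover_union_le M n)); rewrite lee_fin -/D ler_pdivrMr//.
by rewrite -ler_pdivrMl// mulrC ltW// truncnS_gt.
Qed.

(** If [x] is not Diophantine, each constant [1 / (n + 1)] fails for some [a/q], which puts [x] in
    the union of the [cover M n q] for every [n] once [M > |x|]. *)
Lemma diophantine_ae : mu.-negligible (~` [set x | diophantine eta x]).
Proof.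
apply: negligibleS (negligible_bigcup cover_null) => x /= xD.
exists (Num.truncn `|x|).+1 => //; set M := _.+1 => n _.
have xM : `|x| < M%:R by exact: truncnS_gt.
clearbody M.
have [c [c0 c1 cn]] : exists c : R, [/\ 0 < c, c <= 1 & c = n.+1%:R^-1].
  by exists n.+1%:R^-1; split; rewrite ?invr_gt0 ?invf_le1 ?ltr0n ?ler1n.
apply: contrapT => ncov; apply: xD; exists c => // a q q0.
rewrite leNgt; apply/negP => aq; apply: ncov.
have [q' qE] : exists q' : nat, q = q'.+1%:Z by exists `|q|.-1; lia.
exists q' => //; rewrite /cover.
rewrite -(bigcup_mkord _ (fun j => ball (center M q' j)
  (q'.+1%:R `^ (- (2 + eta)) / n.+1%:R))).
have qR : 0 < q%:~R :> R by rewrite ltr0z.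
have q1 : 1 <= q%:~R :> R by rewrite -[1]/(1%:~R) ler_int; lia.
(* Since [c <= 1], [a/q] is within 1 of [x], so [a] is in the enumerated range. *)
have aM : `|a| <= (M.+1 * q'.+1)%N%:Z.
  have xa : `|x - a%:~R / q%:~R| < 1.
    apply: (lt_le_trans aq); apply: mulr_ile1; rewrite ?powR_ge0 ?(ltW c0)//.
    have := @ge0_powRN_le R (2 + eta) 1 q%:~R.
    by rewrite powR1; apply => //; rewrite addr_ge0// ltW.
  have aq1 : `|a%:~R / q%:~R| <= M.+1%:R :> R.
    have M1 : M.+1%:R = M%:R + 1 :> R by rewrite natr1.
    have := ler_distD x 0 (a%:~R / q%:~R : R); rewrite !sub0r !normrN M1.
    move: xM xa; move: `|x| `|x - _| `|_ / _| (M%:R : R) => u v w z; lra.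
  move: aq1; rewrite normrM normfV (gtr0_norm qR) ler_pdivrMr// -intr_norm.
  by rewrite qE -[_.+1%:R]/(_.+1%:~R) -intrM ler_int; lia.
exists (absz (a + (M.+1 * q'.+1)%N%:Z)).
  by rewrite /= /ncenter; lia.
rewrite /ball /= /center; have -> : (absz (a + (M.+1 * q'.+1)%N%:Z))%:Z - (M.+1 * q'.+1)%N%:Z = a by lia.
by move: aq; rewrite distrC cn qE (mulrC n.+1%:R^-1).
Qed.

End Null.

(** Taking all [eta = 1 / (n + 1)] at once yields a single set of full measure that serves every
    exponent [alpha]. *)
Lemma diophantine_all_ae {R : realType} :
  (@lebesgue_measure R).-negligible
    (~` [set x : R | forall n : nat, diophantine n.+1%:R^-1 x]).
Proof.
have dn (n : nat) : 0 < n.+1%:R^-1 :> R by rewrite invr_gt0.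
apply: negligibleS (negligible_bigcup (fun n => diophantine_ae n.+1%:R^-1 (dn n))).
by move=> x /= /existsNP[n xn]; exists n.
Qed.

Lemma holder_deriv0 {R : realType} (F : R -> R[i]) (alpha x : R) :
  1 < alpha -> holder_at F alpha x -> deriv0_at F x.
Proof.
move=> a1 [C [d d0 FC]] e e0.
(* [|C| + 1] is positive whatever the sign of [C]; the radius below makes
   [D t ^ (alpha - 1) <= e]. *)
pose D := `|C| + 1; have D0 : 0 < D by rewrite ltr_wpDl.
have eD : 0 < e / D by rewrite divr_gt0.
exists (Num.min d ((e / D) `^ (alpha - 1)^-1)); first by rewrite lt_min d0 powR_gt0.
move=> y; rewrite lt_min => /andP[yd yD]; apply: le_trans (FC y yd) _.
set t := `|y - x| in yD *; have t0 : 0 <= t by exact: normr_ge0.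
have a10 : 0 < alpha - 1 by lra.
rewrite -mulr_powRB1//; last by lra.
have tD : t `^ (alpha - 1) <= e / D.
  have := ge0_ler_powR (ltW a10) t0 (powR_ge0 _ _) (ltW yD).
  by rewrite -powRrM mulVf ?gt_eqF// powRr1// ltW.
rewrite mulrCA mulrC; apply: ler_wpM2r => //.
have CD : C <= D by rewrite /D; have := ler_norm C; lra.
apply: le_trans (ler_wpM2r (powR_ge0 _ _) CD) _.
apply: le_trans (ler_wpM2l (ltW D0) tD) _.
by rewrite mulrC divfK ?gt_eqF.
Qed.

Theorem theorem1p4 (R : realType) (k : R[i]) (f : rat -> R[i]) (h : R -> R[i]) :
  0 < complex.Re k ->
  (forall x : rat, f (x + 1) = f x) ->
  (forall x : rat, x != 0 ->
     h (ratr x) = f x - cpow `|ratr x| (- k) * f (- x^-1)) ->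
  (exists C : R, forall x : R, 0 < `|x| <= 1 ->
     cnorm (h x) <= C * `|x| `^ (- complex.Re k)) ->
  exists fstar : R -> R[i],
    (* definition at rationals: f*(a/q) = q^{-k} f(xbar) *)
    (forall y : rat, fstar (ratr y) = fstar_rat k f y) /\
    (* well defined at irrationals: the limit over rationals y -> x exists
       and equals f*(x) *)
    (forall x : R, ~ is_rational x ->
       forall e : R, 0 < e -> exists2 d : R, 0 < d &
         forall y : rat, `|ratr y - x| < d ->
           cnorm (fstar_rat k f y - fstar x) < e) /\
    (* continuous at every irrational point *)
    (forall x : R, ~ is_rational x -> ccont_at fstar x) /\
    (* if h(x) = o(|x|^{-Re k}) as x -> 0, then f* is continuous on R *)
    ((forall e : R, 0 < e -> exists2 d : R, 0 < d &
        forall x : R, 0 < `|x| < d ->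
          cnorm (h x) <= e * `|x| `^ (- complex.Re k)) ->
     forall x : R, ccont_at fstar x) /\
    (* Hoelder continuity on a set of full Lebesgue measure *)
    (exists X : set R, (@lebesgue_measure R).-negligible (~` X) /\
       forall x : R, X x -> forall alpha : R,
         0 < alpha -> alpha < complex.Re k / 2 -> holder_at fstar alpha x) /\
    (* in particular, derivative zero almost everywhere when Re k > 2 *)
    (2 < complex.Re k ->
       {ae (@lebesgue_measure R), forall x : R, deriv0_at fstar x}).
Proof.
move=> k0 f_per fh [C h_bigO].
have [F [F_rat F_lim]] := fstar_extension k f h k0 f_per fh C h_bigO.
have F_irr := fstar_cont_irrational k f h k0 f_per fh C h_bigO F F_rat F_lim.
have F_holder (x : R) : (forall n : nat, diophantine n.+1%:R^-1 x) ->
    forall alpha : R, 0 < alpha -> alpha < complex.Re k / 2 -> holder_at F alpha x.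
  move=> xD alpha a0 ak; have gap : 0 < complex.Re k - 2 * alpha by lra.
  (* For [eta <= 1], [(1 + eta) (2 + eta) <= 2 + 4 eta], so [eta = 1 / (n + 1)] need only be at most
     [(Re k - 2 alpha) / (4 alpha)]. *)
  pose n := Num.truncn (4 * alpha / (complex.Re k - 2 * alpha)).
  apply: (fstar_holder k f h k0 f_per fh C h_bigO F F_rat F_lim n.+1%:R^-1) => //.
  have : 4 * alpha / (complex.Re k - 2 * alpha) < n.+1%:R by exact: truncnS_gt.
  rewrite ltr_pdivrMr// -ltr_pdivrMl// mulrC => eta_small.
  have eta1 : n.+1%:R^-1 <= 1 :> R by rewrite invf_le1 ?ler1n.
  have eta0 : 0 < n.+1%:R^-1 :> R by rewrite invr_gt0.
  move: (n.+1%:R^-1) eta0 eta1 eta_small => eta eta0 eta1 eta_small.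
  have : alpha * ((1 + eta) * (2 + eta)) <= alpha * (2 + 4 * eta).
    by apply: ler_wpM2l; [exact: ltW|nra].
  by lra.
exists F; do 3 (split=> //); split.
  move=> h_o x; have [[y <-]|xirr] := pselect (is_rational x); last exact: F_irr.
  exact: (fstar_cont_rational k f h k0 f_per fh C h_bigO F F_rat F_lim h_o).
split.
  by exists [set x | forall n : nat, diophantine n.+1%:R^-1 x]; split;
    [exact: diophantine_all_ae|].
move=> k2; apply: negligibleS diophantine_all_ae => x /= nx xD; apply: nx.
(* The exponent is the midpoint of 1 and [Re k / 2]. *)
apply: (@holder_deriv0 R F ((1 + complex.Re k / 2) / 2)); first by lra.
by apply: F_holder => //; lra.
Qed.
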